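(* Let $N\in\mathbb{N}$ and let $s_0=1,s_1,\ldots,s_{2N-1}$ be real numbers. There exists an $N\times N$ Jacobi matrix $A^N$ whose spectral measure $d\rho^N$ (Dirichlet boundary condition at $n=N+1$) is supported on $(0,+\infty)$ and satisfies $s_k=\int_{-\infty}^\infty\lambda^k\,d\rho^N(\lambda)$ for $k=0,1,\ldots,2N-1$ if and only if the matrices $S^N_0$ and $S^N_1$ are positive definite.
   Context: An $N\times N$ Jacobi matrix $A^N$ is a real symmetric tridiagonal matrix with diagonal $b_1,\ldots,b_N\in\mathbb{R}$ and off-diagonal entries $a_1,\ldots,a_{N-1}>0$; set $a_0=1$. It corresponds to the difference expression $a_n\psi_{n+1}+a_{n-1}\psi_{n-1}+b_n\psi_n$ on $\{1,\ldots,N\}$ with $\psi_0=0$ and Dirichlet condition $\psi_{N+1}=0$. Let $\lambda_1,\ldots,\lambda_N$ be its (real, distinct) eigenvalues and let $\phi^k\in\mathbb{R}^N$ be the eigenvector for $\lambda_k$ normalized by $\phi^k_1=1$; put $\rho_k=(\phi^k,\phi^k)$. The spectral measure of $A^N$ is $d\rho^N$ with $\rho^N(\lambda)=\sum_{\{k:\lambda_k<\lambda\}}1/\rho_k$, i.e. mass $1/\rho_k$ at each $\lambda_k$ (total mass 1). $S^N_m$ is the $N\times N$ Hankel-type matrix with entries $(S^N_m)_{ij}=s_{2N-i-j+m}$, $i,j=1,\ldots,N$. *)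

(* Defs.v *)
From mathcomp Require Import all_boot all_order all_algebra.
From mathcomp Require Import finmap.
From mathcomp Require Import all_classical all_reals all_analysis.

Set Implicit Arguments.
Unset Strict Implicit.
Unset Printing Implicit Defensive.

Import Order.TTheory GRing.Theory Num.Theory.
Import numFieldNormedType.Exports.

Local Open Scope classical_set_scope.
Local Open Scope ring_scope.

Definition jacobi_matrix (R : realType) (N : nat) (A : 'M[R]_N) : Prop :=
  [/\ A^T = A,
      forall i j : 'I_N, (i.+1 < j)%N -> A i j = 0
    & forall i j : 'I_N, j = i.+1 :> nat -> 0 < A i j].

(* The eigenvalues of A, listed without repetition. The set is finite for
   every square matrix, so that fset_set never takes its default value. *)
Definition eigenvalues (R : realType) (N : nat) (A : 'M[R]_N) : seq R :=
  fset_set [set x : R | eigenvalue A x].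

(* The eigenvector of A for x with first coordinate 1. It is a row vector
   because [eigenvalue] refers to the row action; for a symmetric matrix this
   makes no difference. For a Jacobi matrix and one of its eigenvalues it
   exists and is unique; the default value 0 is used when there is none. *)
Definition normalized_eigenvector (R : realType) (N : nat) (A : 'M[R]_N)
    (x : R) : 'rV[R]_N :=
  xget 0 [set v : 'rV[R]_N |
    v *m A = x *: v /\ forall i : 'I_N, i = 0%N :> nat -> v 0 i = 1].

Definition sq_norm (R : realType) (N : nat) (v : 'rV[R]_N) : R :=
  \sum_(i < N) v 0 i ^+ 2.

Lemma inv_sq_norm_ge0 (R : realType) (N : nat) (v : 'rV[R]_N) :
  0 <= (sq_norm v)^-1.
Proof. by rewrite invr_ge0; apply: sumr_ge0 => i _; exact: sqr_ge0. Qed.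

Definition spectral_weight (R : realType) (N : nat) (A : 'M[R]_N) (x : R) :
    {nonneg R} :=
  NngNum (inv_sq_norm_ge0 (normalized_eigenvector A x)).

Definition spectral_measure (R : realType) (N : nat) (A : 'M[R]_N) :
    {measure set (measurableTypeR R) -> \bar R} :=
  msum (fun k : nat =>
          let x : measurableTypeR R := (eigenvalues A)`_k in
          mscale (spectral_weight A x) (dirac x))
       (size (eigenvalues A)).

Definition supported_on (R : realType)
    (mu : {measure set (measurableTypeR R) -> \bar R}) (D : set R) : Prop :=
  mu (~` D) = 0%E.

(* Ordinals count from 0, whence the successors. *)
Definition hankel_matrix (R : realType) (s : nat -> R) (N m : nat) : 'M[R]_N :=
  \matrix_(i < N, j < N) s (2 * N - i.+1 - j.+1 + m)%N.

Definition positive_definite (R : realType) (N : nat) (M : 'M[R]_N) : Prop :=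
  M^T = M /\ forall v : 'cV[R]_N, v != 0 -> 0 < (v^T *m M *m v) 0 0.

(* Main.v *)
(* For a Jacobi matrix A, let K be the matrix with rows e_1 A^i, i < N. It is
   lower triangular with positive diagonal, and H0 := K K^T and H1 := K A K^T
   have the entries (A^(i+j))_11 and (A^(i+j+1))_11. By the spectral theorem
   (A^k)_11 is the k-th moment of the spectral measure, and this measure lives on
   the positive half-line exactly when A is positive definite; so H0 and H1, which
   are the Hankel matrices up to reversal of the indices, are positive definite.
   Conversely, given H0 and H1, the Cholesky factor G of H0 has to be K, which
   forces A = G^-1 H1 G^-T. Since H1 is H0 shifted, A shifts the rows of the
   triangular matrix G, and is therefore a Jacobi matrix with K = G. *)
Require Import Defs.
From mathcomp Require Import all_boot all_order all_algebra.
From mathcomp Require Import perm complex finmap ring zify.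
From mathcomp Require Import all_classical all_reals all_analysis.
From mathcomp Require Import measurable_realfun.
Import Order.TTheory GRing.Theory Num.Theory.
Import numFieldNormedType.Exports.
Local Open Scope classical_set_scope.
Local Open Scope ring_scope.

Set Implicit Arguments.
Unset Strict Implicit.

(** * Hessenberg matrices and simplicity of the spectrum *)

(** This form of the Jacobi condition makes sense over any field, so that it passes to the complex
    numbers, where the spectral theorem is applied. *)
Definition unreduced_hessenberg (F : fieldType) (n : nat) (A : 'M[F]_n) :=
  (forall i j : 'I_n, (j.+1 < i)%N -> A i j = 0) /\
  (forall i j : 'I_n, i = j.+1 :> nat -> A i j != 0).

(** Column [j] of [v *m A = x *: v] expresses coordinate [j + 1] of [v], times a nonzero subdiagonal
    entry, through the coordinates up to [j]; so the first coordinate determines all of [v]. *)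
Lemma hessenberg_eigenvector_eq0 (F : fieldType) (n : nat) (A : 'M[F]_n.+1)
    (x : F) (v : 'rV[F]_n.+1) :
  unreduced_hessenberg A -> v *m A = x *: v -> v 0 0 = 0 -> v = 0.
Proof.
move=> [A0 Asub] vA v0.
suff vk k : forall i : 'I_n.+1, (i <= k)%N -> v 0 i = 0.
  by apply/rowP => i; rewrite mxE (vk n) // -ltnS.
elim: k => [|k IH] i.
  by rewrite leqn0 => /eqP i0; rewrite -v0; congr (v _ _); exact: val_inj.
rewrite leq_eqVlt => /predU1P[ik|]; last exact: IH.
have kn : (k < n.+1)%N by rewrite ltnW // -ik.
pose j := Ordinal kn.
have /rowP/(_ j) := vA; rewrite !mxE (IH j) // mulr0.
rewrite (bigD1 i) //= big1 ?addr0 => [|l li].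
  by move=> /eqP; rewrite mulf_eq0 (negbTE (Asub i j ik)) orbF => /eqP.
have [lk|kl] := leqP l k; first by rewrite IH ?mul0r.
by rewrite A0 ?mulr0 //= ltn_neqAle -ik eq_sym li ik.
Qed.

Lemma row_unitmx_neq0 (F : fieldType) (n : nat) (P : 'M[F]_n) (i : 'I_n) :
  P \in unitmx -> row i P != 0.
Proof.
rewrite -row_free_unit => /row_freeP[Q] /(congr1 (row i)) PQ.
apply/eqP => ri; move: PQ; rewrite row_mul ri mul0mx => /rowP/(_ i)/eqP.
by rewrite !mxE eqxx eq_sym oner_eq0.
Qed.

Section SpectralDiag.
Local Open Scope sesquilinear_scope.

Lemma spectral_diag_inj (C : numClosedFieldType) (n : nat) (A : 'M[C]_n.+1) :
  A \is normalmx -> unreduced_hessenberg A ->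
  injective (spectral_diag A 0).
Proof.
move=> /orthomx_spectralP Adec AH.
set P := spectralmx A in Adec; set d := spectral_diag A in Adec *.
have Pu : P \in unitmx := spectral_unit A.
have PA : P *m A = diag_mx d *m P by rewrite Adec !mulmxA mulmxV // mul1mx.
have rowA i : row i P *m A = d 0 i *: row i P.
  by rewrite -row_mul PA row_mul row_diag_mx -scalemxAl -rowE.
have row_neq0 i : P i 0 != 0.
  apply: contra (row_unitmx_neq0 i Pu) => /eqP Pi0; apply/eqP.
  by apply: (hessenberg_eigenvector_eq0 (x := d 0 i) AH); rewrite ?mxE.
move=> i j dij; apply/eqP/negPn/negP => nij.
(* This combination of two eigenvectors for the same eigenvalue has first coordinate 0, hence
   vanishes, although the rows of [P] are independent and [P j 0] is nonzero. *)
pose v := P j 0 *: row i P - P i 0 *: row j P.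
have v0 : v = 0.
  apply: (hessenberg_eigenvector_eq0 (x := d 0 i) AH).
    rewrite mulmxBl -!scalemxAl !rowA -dij scalerBr !scalerA.
    by rewrite ![_ * d 0 i]mulrC.
  by rewrite !mxE mulrC subrr.
have := congr1 (mulmx^~ (invmx P)) v0.
rewrite mul0mx mulmxBl -!scalemxAl -!row_mul mulmxV // => /rowP/(_ i).
rewrite !mxE eqxx mulr1 eq_sym (negbTE nij) mulr0 subr0 => /eqP.
by rewrite (negbTE (row_neq0 j)).
Qed.

(** Over the complex numbers [A] becomes Hermitian, so it is unitarily diagonalizable with real, and
    by the previous lemma distinct, eigenvalues. Being an eigenvalue descends along the embedding of
    the reals. *)
Lemma symmetric_hessenberg_eigenvalues (R : rcfType) (n : nat)
    (A : 'M[R]_n.+1) :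
  A^T = A -> unreduced_hessenberg A ->
  exists2 d : 'I_n.+1 -> R, injective d & forall i, eigenvalue A (d i).
Proof.
move=> Asym [A0 Asub]; pose C : numClosedFieldType := complex.complex R.
pose f : {rmorphism R -> C} := @complex.real_complex_def R (Phant R).
pose B : 'M[C]_n.+1 := map_mx f A.
have BH : unreduced_hessenberg B.
  split=> i j ij; rewrite mxE; first by rewrite A0 // rmorph0.
  by rewrite fmorph_eq0 Asub.
have Bherm : B \is hermsymmx.
  apply: realsym_hermsym.
    by apply/is_hermitianmxP; rewrite expr0 scale1r map_mx_id // map_trmx Asym.
  apply/mxOverP => i j; rewrite mxE; apply/complex.complex_realP.
  by exists (A i j).
have /mxOverP dreal := hermitian_spectral_diag_real Bherm.
have Bnorm := hermitian_normalmx Bherm.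
have dE i : spectral_diag B 0 i = f (complex.Re (spectral_diag B 0 i)).
  by rewrite /f /= complex.RRe_real.
exists (fun i => complex.Re (spectral_diag B 0 i)).
  move=> i j eqd; apply: (spectral_diag_inj Bnorm BH).
  by rewrite dE eqd -dE.
move=> i; rewrite -(eigenvalue_map f) -dE; apply/eigenvalueP.
exists (row i (spectralmx B)); last by rewrite row_unitmx_neq0 ?spectral_unit.
have /orthomx_spectralP Bdec := Bnorm.
rewrite -row_mul [X in _ *m X]Bdec !mulmxA mulmxV ?spectral_unit // mul1mx.
by rewrite row_mul row_diag_mx -scalemxAl -rowE.
Qed.

End SpectralDiag.

(** * Eigenvalues and normalized eigenvectors of a Jacobi matrix *)

Lemma mem_eigenvalues (R : realType) (n : nat) (A : 'M[R]_n) (x : R) :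
  (x \in eigenvalues A) = eigenvalue A x.
Proof.
have p0 : char_poly A != 0 by rewrite monic_neq0 ?char_poly_monic.
(* Finiteness keeps [fset_set] off its default value: an infinite set would contain more roots of
   [char_poly A] than its degree allows. *)
have fin : finite_set [set x : R | eigenvalue A x].
  apply: contrapT => /infinite_set_fsetP/(_ (size (char_poly A)))[B BA].
  rewrite leqNgt (max_poly_roots p0) ?fset_uniq //.
  by apply/allP => y /BA /=; rewrite eigenvalue_root_char.
by rewrite [LHS](in_fset_set fin); apply/idP/idP; rewrite inE.
Qed.

Lemma jacobi_hessenberg (R : realType) (n : nat) (A : 'M[R]_n) :
  jacobi_matrix A -> unreduced_hessenberg A.
Proof.
case=> Asym A0 Apos; split=> i j ij; rewrite -Asym mxE; first exact: A0.
by rewrite gt_eqF ?Apos.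
Qed.

(** The [n + 1] distinct eigenvalues already found exhaust the roots of the characteristic
    polynomial. Indexing them by ordinals lets their eigenvectors be stacked into a square
    matrix. *)
Lemma perm_eigenvalues (R : realType) (n : nat) (A : 'M[R]_n.+1) :
  jacobi_matrix A ->
  exists2 d : 'I_n.+1 -> R, injective d & perm_eq (eigenvalues A) (codom d).
Proof.
move=> AJ; have [Asym _ _] := AJ.
have [d dinj dP] := symmetric_hessenberg_eigenvalues Asym (jacobi_hessenberg AJ).
exists d => //; rewrite perm_sym.
have du : uniq (codom d) by rewrite map_inj_uniq ?enum_uniq.
have dsub : {subset codom d <= eigenvalues A}.
  by move=> _ /codomP[i ->]; rewrite mem_eigenvalues.
have [|_ dE] := uniq_min_size du dsub; last exact: uniq_perm (fset_uniq _) dE.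
rewrite size_codom card_ord -ltnS -(size_char_poly A); apply: max_poly_roots.
- by rewrite monic_neq0 ?char_poly_monic.
- by apply/allP => y; rewrite mem_eigenvalues eigenvalue_root_char.
- exact: fset_uniq.
Qed.

(** The first coordinate of an eigenvector cannot vanish, so rescaling is possible and [xget] does
    not return its default. *)
Lemma normalized_eigenvectorP (R : realType) (n : nat) (A : 'M[R]_n.+1) (x : R)
    (v := normalized_eigenvector A x) :
  jacobi_matrix A -> eigenvalue A x -> v *m A = x *: v /\ v 0 0 = 1.
Proof.
move=> AJ /eigenvalueP[u uA u0].
suff [vA v1] : [set v : 'rV[R]_n.+1 | v *m A = x *: v /\
    forall i : 'I_n.+1, i = 0%N :> nat -> v 0 i = 1] v by split; rewrite ?v1.
apply: xgetPex; exists ((u 0 0)^-1 *: u); split.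
  by rewrite -scalemxAl uA !scalerA mulrC.
move=> i /= i0; have -> : i = 0 by apply: val_inj.
rewrite mxE mulVf //; apply: contra u0 => /eqP u00.
by apply/eqP; apply: hessenberg_eigenvector_eq0 (jacobi_hessenberg AJ) uA u00.
Qed.

Lemma sq_norm_normalized_gt0 (R : realType) (n : nat) (A : 'M[R]_n.+1) (x : R) :
  jacobi_matrix A -> eigenvalue A x ->
  0 < sq_norm (normalized_eigenvector A x).
Proof.
move=> AJ Ax; have [_ v0] := normalized_eigenvectorP AJ Ax.
rewrite /sq_norm (bigD1 ord0) //= v0 expr1n ltr_pwDl // sumr_ge0 // => i _.
exact: sqr_ge0.
Qed.

(** * Spectral decomposition and moments *)

(** The normalized eigenvectors, stacked as the rows of [B], are orthogonal with squared norms
    inverse to the weights [W]. This yields the resolution of the identity [B^T *m W *m B = 1],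
    which is then multiplied by [A ^+ k]. *)
Lemma jacobi_spectral_decomposition (R : realType) (n : nat) (A : 'M[R]_n.+1)
    (k : nat) (phi := normalized_eigenvector A) :
  jacobi_matrix A ->
  A ^+ k = \sum_(x <- eigenvalues A)
    (x ^+ k / sq_norm (phi x)) *: ((phi x)^T *m phi x).
Proof.
move=> AJ; have [Asym _ _] := AJ; have [d dinj dperm] := perm_eigenvalues AJ.
have dP i : eigenvalue A (d i).
  by rewrite -mem_eigenvalues (perm_mem dperm) codom_f.
have phiA i : phi (d i) *m A = d i *: phi (d i).
  by have [] := normalized_eigenvectorP AJ (dP i).
have rho_gt0 i : 0 < sq_norm (phi (d i)) by exact: sq_norm_normalized_gt0.
pose B := \matrix_(i < n.+1) phi (d i).
pose W := diag_mx (\row_i (sq_norm (phi (d i)))^-1).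
have rowB i : row i B = phi (d i) by exact: rowK.
have phi_dot i j : i != j -> (phi (d i) *m (phi (d j))^T) 0 0 = 0.
  move=> ij; have : phi (d i) *m A *m (phi (d j))^T
      = phi (d i) *m (phi (d j) *m A)^T by rewrite trmx_mul Asym mulmxA.
  rewrite !phiA linearZ /= -scalemxAr -scalemxAl => /eqP.
  rewrite -subr_eq0 -scalerBl scalemx_eq0 subr_eq0 (inj_eq dinj) (negbTE ij).
  by move=> /eqP ->; rewrite mxE.
have WBB : W *m B *m B^T = 1%:M.
  apply/matrixP => i j; rewrite -mulmxA mul_diag_mx !mxE.
  have -> : \sum_l B i l * B^T l j = (phi (d i) *m (phi (d j))^T) 0 0.
    by rewrite mxE; apply: eq_bigr => l _; rewrite !mxE.
  have [<-|ij] := eqVneq; last by rewrite phi_dot ?mulr0.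
  rewrite -[RHS](mulVf (lt0r_neq0 (rho_gt0 i))) mxE; congr (_ * _).
  by apply: eq_bigr => l _; rewrite mxE.
(* For square matrices a one-sided inverse is two-sided: orthogonality turns into completeness. *)
have BWB : B^T *m W *m B = 1%:M by rewrite -mulmxA mulmx1C.
have BA : B *m A ^+ k = diag_mx (\row_i d i ^+ k) *m B.
  apply/row_matrixP => i; rewrite !row_mul row_diag_mx -scalemxAl -rowE rowB mxE.
  elim: k => [|k IH]; first by rewrite !expr0 mulmx1 scale1r.
  rewrite exprSr -[A ^+ k * A]/(A ^+ k *m A) mulmxA IH.
  by rewrite -scalemxAl phiA scalerA exprSr.
rewrite -[LHS]mul1mx -BWB -mulmxA BA (perm_big _ dperm) big_image /=.
apply/matrixP => i j; rewrite summxE mxE; apply: eq_bigr => l _.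
by rewrite mul_mx_diag mul_diag_mx !mxE big_ord1 !mxE; ring.
Qed.

(** The normalization makes the corner entry of each rank-one term equal to 1, so only the spectral
    weights remain. *)
Lemma jacobi_moment (R : realType) (n : nat) (A : 'M[R]_n.+1) (k : nat) :
  jacobi_matrix A ->
  (A ^+ k) 0 0 = \sum_(x <- eigenvalues A)
    x ^+ k / sq_norm (normalized_eigenvector A x).
Proof.
move=> AJ; rewrite (jacobi_spectral_decomposition _ AJ) summxE.
rewrite big_seq [RHS]big_seq; apply: eq_bigr => x; rewrite mem_eigenvalues => Ax.
have [_ v0] := normalized_eigenvectorP AJ Ax.
by rewrite !mxE big_ord1 !mxE v0 !mulr1.
Qed.

(** * Integration against the spectral measure, and its support *)

Lemma integral_spectral_measure (R : realType) (n : nat) (A : 'M[R]_n)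
    (f : measurableTypeR R -> R) : measurable_fun setT f ->
  (\int[spectral_measure A]_x (f x)%:E =
   (\sum_(x <- eigenvalues A)
      f x / sq_norm (normalized_eigenvector A x))%:E)%E.
Proof.
move=> mf.
have ge0_case (g : measurableTypeR R -> R) : measurable_fun setT g -> (forall x, 0 <= g x) ->
    (\int[spectral_measure A]_x (g x)%:E =
     (\sum_(x <- eigenvalues A)
        g x / sq_norm (normalized_eigenvector A x))%:E)%E.
  move=> mg g0; have /measurable_EFinP mEg := mg.
  have g_ge0 x : setT x -> (0 <= (g x)%:E)%E by rewrite lee_fin.
  rewrite ge0_integral_measure_sum // (big_nth (0 : R)) big_mkord -sumEFin.
  apply: eq_bigr => k _; rewrite ge0_integral_mscale // integral_dirac //.
  by rewrite diracT mul1e -EFinM mulrC.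
(* The positive and negative parts both integrate to finite sums of reals, so their difference can
   be taken in [R]. *)
rewrite integralE.
have posE : (fun x => (f x)%:E)^\+%E = (fun x => (f^\+ x)%:E).
  by apply/funext => x; rewrite funeposE -EFin_max.
have negE : (fun x => (f x)%:E)^\-%E = (fun x => (f^\- x)%:E).
  by apply/funext => x; rewrite funenegE -EFinN -EFin_max.
rewrite posE negE !ge0_case //; last exact: measurable_funrpos.
  rewrite -EFinB -sumrB; congr (_%:E); apply: eq_bigr => x _.
  by rewrite -mulrBl -[in RHS](funrposBneg f).
exact: measurable_funrneg.
Qed.

Lemma spectral_measureE (R : realType) (n : nat) (A : 'M[R]_n) (D : set R) :
  spectral_measure A D = (\sum_(x <- eigenvalues A)
    \1_D x / sq_norm (normalized_eigenvector A x))%:E.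
Proof.
rewrite /spectral_measure /= /msum (big_nth (0 : R)) big_mkord -sumEFin.
by apply: eq_bigr => k _; rewrite /= /mscale /= /dirac -EFinM mulrC.
Qed.

(** Every eigenvalue carries strictly positive mass, so a null set contains none of them. *)
Lemma spectral_measure_supportP (R : realType) (n : nat) (A : 'M[R]_n.+1)
    (D : set R) : jacobi_matrix A ->
  supported_on (spectral_measure A) D <-> forall x, eigenvalue A x -> D x.
Proof.
move=> AJ; rewrite /supported_on spectral_measureE.
have term_ge0 (x : R) : 0 <= \1_(~` D) x / sq_norm (normalized_eigenvector A x).
  by rewrite mulr_ge0 ?inv_sq_norm_ge0.
split=> [[] /eqP|DA].
  rewrite psumr_eq0 // => /allP sum0 x Ax.
  have := sum0 x; rewrite mem_eigenvalues Ax => /(_ isT).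
  rewrite mulf_eq0 invr_eq0 [in X in _ || X]gt_eqF ?sq_norm_normalized_gt0 // orbF.
  by rewrite indicE pnatr_eq0 eqb0 notin_setE => /contrapT.
rewrite big_seq big1 // => x; rewrite mem_eigenvalues => /DA Dx.
by rewrite indicE memNset ?mul0r //; apply.
Qed.

(** * Positive definite matrices: congruence, spectrum, Cholesky factorization *)

Lemma positive_definite_congruence (R : realType) (m n : nat) (M : 'M[R]_n)
    (P : 'M[R]_(m, n)) :
  row_free P -> positive_definite M -> positive_definite (P *m M *m P^T).
Proof.
move=> Pfree [Msym Mpos]; split; first by rewrite !trmx_mul trmxK Msym mulmxA.
move=> v v0; set w := P^T *m v.
have -> : v^T *m (P *m M *m P^T) *m v = w^T *m M *m w.
  by rewrite trmx_mul trmxK !mulmxA.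
apply: Mpos; apply: contra v0 => /eqP Pv; rewrite -trmx_eq0.
apply/eqP; apply: (row_free_inj Pfree).
by rewrite mul0mx -[P]trmxK -trmx_mul [P^T *m v]Pv trmx0.
Qed.

Lemma positive_definite_congruent (R : realType) (n : nat) (M P : 'M[R]_n) :
  P \in unitmx ->
  positive_definite (P *m M *m P^T) <-> positive_definite M.
Proof.
move=> Pu; split; last by apply: positive_definite_congruence; rewrite row_free_unit.
move=> PMP; have -> : M = invmx P *m (P *m M *m P^T) *m (invmx P)^T.
  by rewrite !mulmxA mulVmx // mul1mx -mulmxA -trmx_mul mulVmx // trmx1 mulmx1.
by apply: positive_definite_congruence; rewrite // row_free_unit unitmx_inv.
Qed.

Lemma positive_definite1 (R : realType) (n : nat) :
  positive_definite (1%:M : 'M[R]_n).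
Proof.
split=> [|v v0]; first exact: trmx1.
rewrite mulmx1 mxE.
have [i vi] : exists i, v i 0 != 0.
  apply/existsP; apply: contraR v0 => /existsPn v0; apply/eqP/colP => i.
  by rewrite mxE; apply/eqP/negPn/v0.
rewrite (bigD1 i) //= mxE ltr_pwDl ?sumr_ge0 // => [|j _].
  by rewrite -expr2 lt_def sqr_ge0 sqrf_eq0 vi.
by rewrite mxE -expr2 sqr_ge0.
Qed.

Lemma jacobi_positive_definite (R : realType) (n : nat) (A : 'M[R]_n.+1) :
  jacobi_matrix A ->
  positive_definite A <-> forall x, eigenvalue A x -> 0 < x.
Proof.
move=> AJ; have [Asym _ _] := AJ; split.
  move=> [_ Apos] x /eigenvalueP[u uA u0].
  have ut0 : u^T != 0 by rewrite trmx_eq0.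
  have := Apos _ ut0; rewrite trmxK uA -scalemxAl mxE.
  have := (positive_definite1 R n.+1).2 _ ut0; rewrite trmxK mulmx1 => uu.
  by rewrite pmulr_lgt0.
move=> eig_gt0; split=> // v v0.
pose phi := normalized_eigenvector A.
(* The form is needed for two exponents: at [k = 1] it is the quantity to bound, at [k = 0] it is
   the squared norm of [v]. As the eigenvalues are positive, if no term at [k = 1] were positive,
   all terms at [k = 0] would vanish. *)
have form k : (v^T *m A ^+ k *m v) 0 0 =
    \sum_(x <- eigenvalues A) x ^+ k / sq_norm (phi x) * (phi x *m v) 0 0 ^+ 2.
  rewrite (jacobi_spectral_decomposition k AJ) mulmx_sumr mulmx_suml summxE.
  apply: eq_bigr => x _; rewrite -scalemxAr -scalemxAl mxE; congr (_ * _).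
  by rewrite mulmxA -(mulmxA (v^T *m _)) -trmx_mul mxE big_ord1 mxE.
have w_gt0 x : x \in eigenvalues A -> 0 < (sq_norm (phi x))^-1.
  by rewrite mem_eigenvalues invr_gt0; apply: sq_norm_normalized_gt0.
have term_ge0 x : x \in eigenvalues A ->
    0 <= x / sq_norm (phi x) * (phi x *m v) 0 0 ^+ 2.
  move=> xA; rewrite mulr_ge0 ?sqr_ge0 // mulr_ge0 ?ltW ?w_gt0 //.
  by rewrite eig_gt0 // -mem_eigenvalues.
have := form 1%N; rewrite expr1 => ->.
rewrite lt_def; apply/andP; split; last first.
  by rewrite big_seq sumr_ge0 // => x /term_ge0; rewrite expr1.
rewrite big_seq psumr_neq0; last by move=> x /term_ge0; rewrite expr1.
have := (positive_definite1 R n.+1).2 _ v0.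
rewrite -[1%:M]/(A ^+ 0) form; apply: contraTT => /hasPn tm0.
rewrite big_seq big1 ?ltxx // => x xA; have := tm0 x xA.
have x_gt0 : 0 < x by rewrite eig_gt0 // -mem_eigenvalues.
rewrite xA /= expr1 -mulrA (pmulr_rgt0 _ x_gt0) -leNgt => le0.
apply/eqP; rewrite eq_le expr0 mul1r le0 mulr_ge0 ?sqr_ge0 //.
by rewrite ltW ?w_gt0.
Qed.

(** Reversing the order of the basis is a congruence by a permutation matrix, and it turns the
    decreasing indices into [i + j + m]. *)
Lemma hankel_matrix_reverse (R : realType) (s : nat -> R) (N m : nat) :
  positive_definite (hankel_matrix s N m) <->
  positive_definite (\matrix_(i < N, j < N) s (i + j + m)%N).
Proof.
pose P := perm_mx (perm (@rev_ord_inj N)) : 'M[R]_N.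
have Pu : P \in unitmx by rewrite unitmx_perm.
rewrite -[X in _ <-> X](positive_definite_congruent _ Pu).
suff -> : hankel_matrix s N m = P *m (\matrix_(i, j) s (i + j + m)%N) *m P^T by [].
rewrite tr_perm_mx -row_permE -col_permE; apply/matrixP => i j; rewrite !mxE !permE /=.
by congr (s _); rewrite mul2n -addnn; have := ltn_ord i; have := ltn_ord j; lia.
Qed.

Lemma block_positive_definite (R : realType) (m n : nat) (M : 'M[R]_m)
    (M' : 'M[R]_n) :
  positive_definite (block_mx M 0 0 M') ->
  positive_definite M /\ positive_definite M'.
Proof.
move=> [sym pos]; move: (sym); rewrite tr_block_mx => /eq_block_mx[symM _ _ symM'].
split; split=> // v v0.
  have := pos (col_mx v 0); rewrite tr_col_mx mul_row_block mul_row_col.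
  rewrite !(mulmx0, mul0mx, trmx0, addr0); apply; apply: contra v0 => /eqP.
  by rewrite -[0 in RHS]col_mx0 => /eq_col_mx[-> _].
have := pos (col_mx 0 v); rewrite tr_col_mx mul_row_block mul_row_col.
rewrite !(mulmx0, mul0mx, trmx0, add0r); apply; apply: contra v0 => /eqP.
by rewrite -[0 in RHS]col_mx0 => /eq_col_mx[_ ->].
Qed.

(** Induction on the size: eliminating the first row and column by a congruence leaves the Schur
    complement [S], which is again positive definite. *)
Lemma cholesky (R : realType) (n : nat) (M : 'M[R]_n) :
  positive_definite M ->
  exists G : 'M[R]_n, [/\ is_trig_mx G, forall i, 0 < G i i & M = G *m G^T].
Proof.
elim: n M => [|n IH] M Mpos.
  by exists 0; split=> [||]; [apply/is_trig_mxP => -[] | case | apply/matrixP => -[]].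
pose a := M 0 0; pose c : 'cV[R]_n := dlsubmx (M : 'M[R]_(1 + n)).
pose D : 'M[R]_n := drsubmx (M : 'M[R]_(1 + n)).
have Msym : M^T = M by case: Mpos.
have Mblock : M = block_mx a%:M c^T c D :> 'M[R]_(1 + n).
  rewrite -[LHS](@submxK _ 1 n 1 n) /c trmx_dlsub Msym; congr block_mx.
  by rewrite [LHS]mx11_scalar !mxE lshift0.
have a_gt0 : 0 < a.
  have e0 : (delta_mx 0 0 : 'cV[R]_n.+1) != 0.
    by apply/eqP => /colP/(_ 0)/eqP; rewrite !mxE !eqxx oner_eq0.
  have := Mpos.2 _ e0; rewrite trmx_delta -rowE -colE.
  by rewrite !mxE.
pose r := Num.sqrt a.
have r_gt0 : 0 < r by rewrite sqrtr_gt0.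
have rr : r * r = a by rewrite -expr2 sqr_sqrtr ?ltW.
pose S := D - a^-1 *: (c *m c^T).
pose E : 'M[R]_(1 + n) := block_mx 1%:M 0 (- a^-1 *: c) 1%:M.
have Eu : E \in unitmx by rewrite unitmxE det_lblock !det1 mulr1 unitr1.
have ES : E *m (block_mx a%:M c^T c D) *m E^T = block_mx a%:M 0 0 S.
  rewrite /E tr_block_mx !mulmx_block !(trmx0, trmx1, mulmx0, mul0mx,
    mul1mx, mulmx1, addr0, add0r) linearZ /=.
  have ca : (- a^-1 *: c) *m a%:M = - c.
    by rewrite mul_mx_scalar scalerA mulrN mulfV ?gt_eqF // scaleN1r.
  rewrite ca addNr mul0mx add0r mul_scalar_mx scalerA mulrN mulfV ?gt_eqF //.
  by rewrite scaleN1r addNr -scalemxAl scaleNr [_ + D]addrC.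
have /block_positive_definite[_ /IH[G [Gtrig Gpos SG]]] :
    positive_definite (block_mx (a%:M : 'M[R]_1) 0 0 S).
  by rewrite -ES -Mblock; apply/positive_definite_congruent.
(* The first column is forced: its corner squares to [a], and its product with the entries below has
   to give [c]. The rank-one term that this adds to [G *m G^T] restores [D] from [S]. *)
pose H : 'M[R]_(1 + n) := block_mx r%:M 0 (r^-1 *: c) G.
exists H; split.
- have -> := @is_trig_block_mx R 1 n 1 n r%:M 0 (r^-1 *: c) G erefl.
  by rewrite eqxx mx11_is_trig.
- move=> i; case: (@split_ordP 1 n i) => j ->.
    by rewrite [X in 0 < X](block_mxEul _ _ _ _ j j) mxE eqxx.
  by rewrite [X in 0 < X](block_mxEdr _ _ _ _ j j).
- rewrite [RHS](_ : _ = H *m H^T) // /H tr_block_mx mulmx_block.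
  rewrite !(trmx0, mulmx0, mul0mx, addr0, add0r) tr_scalar_mx -SG /S linearZ /=.
  rewrite -scalar_mxM rr mul_scalar_mx scalerA mulfV ?gt_eqF // scale1r.
  rewrite mul_mx_scalar scalerA mulfV ?gt_eqF // scale1r.
  rewrite -scalemxAl -scalemxAr scalerA -invfM rr addrCA subrr addr0.
  exact: Mblock.
Qed.

(** * The Krylov matrix and its Gram matrices *)

Definition krylov_mx (R : realType) (n : nat) (A : 'M[R]_n.+1) : 'M[R]_n.+1 :=
  \matrix_(i < n.+1) row 0 (A ^+ i).

Lemma krylov_gram (R : realType) (n : nat) (A : 'M[R]_n.+1) (m : nat) :
  A^T = A ->
  krylov_mx A *m A ^+ m *m (krylov_mx A)^T =
  \matrix_(i, j) (A ^+ (i + j + m)) 0 0.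
Proof.
move=> Asym; have AXsym k : (A ^+ k)^T = A ^+ k.
  elim: k => [|k IH]; first exact: trmx1.
  by rewrite exprS [LHS](trmx_mul A) IH Asym -exprS exprSr.
have rowK i : row i (krylov_mx A *m A ^+ m) = row 0 (A ^+ (i + m)).
  by rewrite row_mul rowK -row_mul exprD.
apply/matrixP => i j; rewrite [RHS]mxE addnAC exprD [RHS]mxE [LHS]mxE.
apply: eq_bigr => l _; congr (_ * _).
  by have /rowP/(_ l) := rowK i; rewrite !mxE.
by rewrite -[in RHS]AXsym !mxE.
Qed.

(** Each multiplication by the tridiagonal [A] extends the support of the first row of [A ^+ k] by
    one place, and the new last entry is the old one times a positive off-diagonal entry. *)
Lemma krylov_trig (R : realType) (n : nat) (A : 'M[R]_n.+1) :
  jacobi_matrix A ->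
  is_trig_mx (krylov_mx A) /\ forall i, 0 < krylov_mx A i i.
Proof.
case=> _ A0 Apos.
suff AX k : (forall j : 'I_n.+1, (k < j)%N -> (A ^+ k) 0 j = 0) /\
    (forall j : 'I_n.+1, j = k :> nat -> 0 < (A ^+ k) 0 j).
  split=> [|i]; last by rewrite !mxE; apply: (AX i).2.
  by apply/is_trig_mxP => i j ij; rewrite !mxE; apply: (AX i).1.
elim: k => [|k [IH0 IHpos]].
  split=> j j0; rewrite expr0 mxE; first by move: j0; case: eqVneq => // <-.
  by have -> : j = 0 by [apply: val_inj]; rewrite eqxx.
have AS j : (A ^+ k.+1) 0 j = \sum_l (A ^+ k) 0 l * A l j by rewrite exprSr mxE.
split=> j kj; rewrite AS.
  rewrite big1 // => l _; have [lk|kl] := leqP l k; last by rewrite IH0 ?mul0r.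
  by rewrite A0 ?mulr0 // (leq_ltn_trans _ kj).
have kn : (k < n.+1)%N by rewrite -ltnS -kj ltnW // ltnS.
rewrite (bigD1 (Ordinal kn)) //= big1 ?addr0 => [|l lk].
  by rewrite mulr_gt0 ?IHpos ?Apos.
have [/IH0->|l_le_k] := ltnP k l; first by rewrite mul0r.
rewrite A0 ?mulr0 // kj ltnS ltn_neqAle l_le_k andbT.
by apply: contra lk => /eqP lk; apply/eqP/val_inj.
Qed.

Lemma trig_unitmx (F : fieldType) (n : nat) (G : 'M[F]_n) :
  is_trig_mx G -> (forall i, G i i != 0) -> G \in unitmx.
Proof.
move=> Gtrig G0; rewrite unitmxE det_trig // unitfE prodf_seq_neq0.
by apply/allP => i _; rewrite G0.
Qed.

(** * Reconstruction of the Jacobi matrix from its moments *)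

Lemma jacobi_of_hankel (R : realType) (n : nat) (s : nat -> R) :
  s 0%N = 1 ->
  positive_definite (\matrix_(i < n.+1, j < n.+1) s (i + j + 0)%N) ->
  positive_definite (\matrix_(i < n.+1, j < n.+1) s (i + j + 1)%N) ->
  exists A : 'M[R]_n.+1, [/\ jacobi_matrix A, positive_definite A
    & forall k, (k <= 2 * n.+1 - 1)%N -> s k = (A ^+ k) 0 0].
Proof.
set H0 := \matrix_(i, j) s (i + j + 0)%N; set H1 := \matrix_(i, j) s (i + j + 1)%N.
move=> s0 /cholesky[G [/[dup] Gtrig /is_trig_mxP G0 Gpos H0E]] H1pos.
have Gu : G \in unitmx by apply: trig_unitmx => // i; rewrite gt_eqF.
have GTu : G^T \in unitmx by rewrite unitmx_tr.
pose A := invmx G *m H1 *m (invmx G)^T.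
have Apos : positive_definite A.
  by apply/positive_definite_congruent; rewrite ?unitmx_inv.
have GAG : G *m A *m G^T = H1.
  by rewrite /A trmx_inv !mulmxA mulmxV // mul1mx mulmxKV.
clearbody A.
(* The rows of H1 are shifted rows of H0 = G G^T, so A shifts the rows of G. *)
have GA (i i' : 'I_n.+1) : i' = i.+1 :> nat -> row i G *m A = row i' G.
  move=> ii'; apply: (can_inj (mulmxK GTu)).
  rewrite -!row_mul GAG -H0E; apply/rowP => j; rewrite !mxE ii'.
  by rewrite addn0 addn1.
have AJ : jacobi_matrix A.
  suff Aij k : forall i j : 'I_n.+1, i = k :> nat ->
      ((i.+1 < j)%N -> A i j = 0) /\ (j = i.+1 :> nat -> 0 < A i j).
    split=> [|i j|i j]; [by case: Apos | exact: (Aij i i j erefl).1 |].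
    exact: (Aij i i j erefl).2.
  elim/ltn_ind: k => k IH i j ik.
  (* In row [i] of [G *m A] only the diagonal term survives right of the diagonal: terms [l > i]
     vanish because [G] is triangular, terms [l < i] by induction, as row [l] of [A] is zero beyond
     column [l + 1]. *)
  have GAij (i' : 'I_n.+1) : i' = i.+1 :> nat -> (i < j)%N -> G i i * A i j = G i' j.
    move=> ii' ij; have /rowP/(_ j) := GA _ _ ii'; rewrite !mxE => <-.
    rewrite (bigD1 i) //= mxE big1 ?addr0 // => l li; rewrite mxE.
    have [il|] := ltnP i l; first by rewrite G0 ?mul0r.
    rewrite leq_eqVlt (inj_eq val_inj) (negbTE li) /= => l_lt_i.
    have [|Alj _] := IH l _ l j erefl; first by rewrite -ik.
    by rewrite Alj ?mulr0 // (leq_ltn_trans _ ij).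
  split=> ij.
    have in1 : (i.+1 < n.+1)%N := ltn_trans ij (ltn_ord j).
    have /eqP := GAij (Ordinal in1) erefl (ltnW ij).
    by rewrite (G0 (Ordinal in1)) // mulf_eq0 gt_eqF //= => /eqP.
  (* Next to the diagonal, [A i j] is the quotient of the consecutive diagonal entries [G j j] and
     [G i i]. *)
  have ij' : (i < j)%N by rewrite ij.
  by rewrite -(pmulr_rgt0 _ (Gpos i)) (GAij j ij ij') Gpos.
have GK : G = krylov_mx A.
  (* The normalization [s 0 = 1] enters here: it gives [G 0 0] the square 1, and positivity selects
     the root. So the first row of [G] is the first unit vector, and the shift property produces the
     other rows. *)
  have G00 : G 0 0 = 1.
    have /matrixP/(_ 0 0) := H0E; rewrite !mxE /= s0 (bigD1 ord0) //= big1.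
      rewrite addr0 !mxE -expr2 => /esym/eqP; rewrite sqrf_eq1 => /predU1P[//|/eqP G1].
      by have := Gpos 0; rewrite G1 oppr_gt0 ltr10.
    by move=> l l0; rewrite G0 ?mul0r // lt0n.
  suff rowG k : forall i : 'I_n.+1, i = k :> nat -> row i G = row 0 (A ^+ k).
    by apply/row_matrixP => i; rewrite rowK; apply: rowG.
  elim: k => [|k IH] i ik.
    have -> : i = 0 by exact: val_inj.
    apply/rowP => j; rewrite expr0 !mxE; have [<-|j0] := eqVneq; first by rewrite G00.
    by rewrite G0 // lt0n eq_sym.
  have kn : (k < n.+1)%N by rewrite ltnW // -ik.
  by rewrite -(GA (Ordinal kn)) // (IH (Ordinal kn)) // -row_mul exprSr.
exists A; split=> // k.
have [Asym _ _] := AJ.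
have s_H0 (i j : 'I_n.+1) : s (i + j)%N = (A ^+ (i + j)) 0 0.
  have /matrixP/(_ i j) := krylov_gram 0 Asym.
  by rewrite -GK expr0 mulmx1 -H0E !mxE addn0.
have s_H1 (i j : 'I_n.+1) : s (i + j).+1 = (A ^+ (i + j).+1) 0 0.
  have /matrixP/(_ i j) := krylov_gram 1 Asym.
  by rewrite -GK expr1 GAG !mxE addn1.
(* Indices up to [2n] are sums of two ordinals and are read off [H0]; the last one, [2n + 1], is the
   bottom corner of [H1]. *)
have [kn _|kn] := leqP k (n + n).
  have [k_le_n|n_lt_k] := leqP k n.
    by have := s_H0 (Ordinal (k_le_n : (k < n.+1)%N)) ord0; rewrite /= addn0.
  have kn1 : (k - n < n.+1)%N by rewrite ltnS leq_subLR.
  by have := s_H0 ord_max (Ordinal kn1); rewrite /= subnKC // ltnW.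
move=> kn2; have -> : k = (n + n).+1 by lia.
exact: (s_H1 ord_max ord_max).
Qed.

(** * The truncated moment problem on the positive half-line *)

Unset Implicit Arguments.
Set Strict Implicit.

Theorem proposition8 (R : realType) (N : nat) (hN : (0 < N)%N)
    (s : nat -> R) (hs0 : s 0%N = 1) :
  (exists A : 'M[R]_N,
    [/\ jacobi_matrix A,
        supported_on (spectral_measure A) `]0, +oo[
      & forall k : nat, (k <= 2 * N - 1)%N ->
          (s k)%:E = (\int[spectral_measure A]_x (x ^+ k)%:E)%E])
  <-> positive_definite (hankel_matrix s N 0) /\
      positive_definite (hankel_matrix s N 1).
Proof.
case: N hN => // n _.
have support_gt0 (A : 'M[R]_n.+1) : jacobi_matrix A ->
    supported_on (spectral_measure A) `]0, +oo[ <-> positive_definite A.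
  move=> AJ; rewrite spectral_measure_supportP // jacobi_positive_definite //.
  by split=> Apos x /Apos; rewrite /= in_itv /= andbT.
have moment (A : 'M[R]_n.+1) (k : nat) : jacobi_matrix A ->
    (\int[spectral_measure A]_x (x ^+ k)%:E)%E = ((A ^+ k) 0 0)%:E.
  by move=> AJ; rewrite jacobi_moment // integral_spectral_measure.
rewrite !hankel_matrix_reverse; split.
  move=> [A [AJ /(support_gt0 _ AJ) Apos sE]].
  have [Asym _ _] := AJ; have [Ktrig Kpos] := krylov_trig AJ.
  have Ku : krylov_mx A \in unitmx by apply: trig_unitmx => // i; rewrite gt_eqF.
  (* The bound on [m] keeps [i + j + m] within the prescribed moments, the largest being [2n + 1].
     The two cases are congruent to the identity and to [A]. *)
  have gram m : (m <= 1)%N ->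
      \matrix_(i < n.+1, j < n.+1) s (i + j + m)%N =
      krylov_mx A *m A ^+ m *m (krylov_mx A)^T.
    move=> m1; rewrite krylov_gram //; apply/matrixP => i j; rewrite !mxE.
    apply: EFin_inj; rewrite sE ?moment //.
    by have := ltn_ord i; have := ltn_ord j; lia.
  rewrite !gram // !positive_definite_congruent //; split => //.
  exact: positive_definite1.
move=> [H0pos H1pos]; have [A [AJ Apos sE]] := jacobi_of_hankel hs0 H0pos H1pos.
exists A; split=> // [|k kN]; first exact/support_gt0.
by rewrite moment // sE.
Qed.
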